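(* Fix an integer $m\ge2$. Let $X_1,\dots,X_n$ be independent random vectors, $H=(V,E)$ an $m$-uniform hypergraph on $V=\{1,\dots,n\}$, $\{h_e\}_{e\in E}$ a collection of $m$-variate kernels, and $$U=\sum_{e=(i_1,i_2,\ldots,i_m)\in E}h_e(X_{i_1},X_{i_2},\ldots,X_{i_m}).$$ Suppose that for every $e=(i_1,\dots,i_m)\in E$ there exists $\sigma_e>0$ such that $$\mathbb{E}\Bigl[e^{\lambda\{h_e(X_{i_1},\ldots,X_{i_m})-\mathbb{E}h_e(X_{i_1},\ldots,X_{i_m})\}}\Bigr]\le e^{\lambda^2\sigma_e^2/2}\qquad\text{for all }\lambda>0.$$ If there exists a proper $K$-edge-coloring of $H$, then for all $t>0$, $$\mathbb{P}(U-\mathbb{E}U>t)\le\exp\left\{-\frac{t^2}{2K\sum_{e\in E}\sigma_e^2}\right\}.$$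
   Context: The random vectors $X_1,\dots,X_n\in\mathbb{R}^p$ are independent but not necessarily identically distributed. In the $m$-uniform hypergraph $H=(V,E)$ (deterministic, with at least one hyper-edge), each hyper-edge $e\in E$ is a subset of $V$ of size $m$, written as $e=(i_1,\dots,i_m)$ in one fixed order of its elements. For each $e\in E$, $h_e:(\mathbb{R}^p)^m\to\mathbb{R}$ is a measurable function (kernel), which may depend on $e$ and need not be symmetric; the expectations $\mathbb{E}h_e(X_{i_1},\dots,X_{i_m})$ are finite. A proper $K$-edge-coloring of $H$ is a partition of the hyper-edges into $K$ non-overlapping groups (color classes, possibly empty) such that any two distinct hyper-edges within the same group share no common node. *)

(* Defs.v *)
From mathcomp Require Import all_boot all_order all_algebra.
From mathcomp Require Import all_classical all_reals all_analysis.

Set Implicit Arguments.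
Unset Strict Implicit.
Unset Printing Implicit Defensive.

Import Order.TTheory GRing.Theory Num.Theory.
Import numFieldNormedType.Exports.

Local Open Scope ring_scope.

Definition mutually_independent d d' (T : measurableType d)
    (T' : measurableType d') (R : realType) (P : probability T R) (I : finType)
    (X : I -> {RV P >-> T'}) : Prop :=
  forall (J : {set I}) (A : I -> set T'),
    (forall i, i \in J -> measurable (A i)) ->
    P (\bigcap_(i in [set` J]) (X i @^-1` A i))%classic =
    (\prod_(i in J) P (X i @^-1` A i)%classic)%E.

Definition uniform_hypergraph (V : finType) (m : nat) (E : {set {set V}}) :
    Prop :=
  forall e, e \in E -> #|e| = m.

(* [ord e] lists the [m] vertices of the hyper-edge [e] in a fixed order; as
   [#|e| = m], the listing has no repetition. Values of [ord] outside [E] are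
   irrelevant. *)
Definition edge_ordering (V : finType) (m : nat) (E : {set {set V}})
    (ord : {set V} -> m.-tuple V) : Prop :=
  forall e, e \in E -> forall i, (i \in ord e) = (i \in e).

(* The color classes [C k] may be empty. *)
Definition proper_edge_coloring (V : finType) (E : {set {set V}}) (K : nat)
    (C : 'I_K -> {set {set V}}) : Prop :=
  [/\ (forall e, (e \in E) = [exists k, e \in C k]),
      (forall k l, k != l -> [disjoint C k & C l]) &
      (forall k e f, e \in C k -> f \in C k -> e != f -> [disjoint e & f])].

(* [R^p] is [p.-tuple R], and [(R^p)^m] is [m.-tuple (p.-tuple R)], with the
   product sigma-algebra, which is the Borel one. *)
Definition edge_value d (T : measurableType d) (R : realType)
    (P : probability T R) (p m : nat) (V : finType)
    (X : V -> {RV P >-> p.-tuple R}) (ord : {set V} -> m.-tuple V)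
    (h : {set V} -> m.-tuple (p.-tuple R) -> R) (e : {set V}) : T -> R :=
  fun w => h e [tuple X (tnth (ord e) j) w | j < m].

Definition Ustat d (T : measurableType d) (R : realType)
    (P : probability T R) (p m : nat) (V : finType)
    (X : V -> {RV P >-> p.-tuple R}) (ord : {set V} -> m.-tuple V)
    (h : {set V} -> m.-tuple (p.-tuple R) -> R) (E : {set {set V}}) : T -> R :=
  fun w => \sum_(e in E) edge_value X ord h e w.

(* Main.v *)
From HB Require Import structures.
Require Import Defs.
From mathcomp Require Import all_boot all_order all_algebra.
From mathcomp Require Import all_classical all_reals all_analysis.
From mathcomp Require Import measurable_realfun ring.
Import Order.TTheory GRing.Theory Num.Theory.
Import numFieldNormedType.Exports.
Local Open Scope ring_scope.
Local Open Scope classical_set_scope.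

(** The bound comes from an estimate of the moment generating function of the
    centred statistic, the sum over all hyper-edges e of Y_e, where Y_e is the
    centred kernel value; the tail bound is then Chernoff's.

    Inside one color class the hyper-edges are disjoint, so the Y_e depend on
    disjoint groups of the X_i and are independent: the moment generating
    function of the class sum S_k is a product, and S_k is sub-Gaussian with
    variance proxy v_k, the sum of sigma_e ^ 2 over the class
    ([expectation_expR_sum_matching]).  This needs the passage from the product
    rule for the X_i to the independence of the sigma-algebras generated by
    disjoint groups of them, which is the pi-lambda theorem
    ([independent_g_sigma_algebra], [cylinders_independent]), and from there to
    the multiplicativity of expectations, which is Fubini-Tonelli
    ([ge0_integral_mul_independent]).

    Different classes may be dependent in any way, so across classes only the
    convexity of the exponential is available.  Writing
    mu * S_k = q_k * ((mu / q_k) * S_k) with weights q_k proportional to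
    sqrt v_k makes all the bounds on E exp ((mu / q_k) * S_k) equal, and shows
    that standard deviations add: the total has variance proxy
    (sum_k sqrt v_k) ^ 2 ([expectation_expR_sum]).  By Cauchy-Schwarz this is at
    most K times the sum of all the sigma_e ^ 2 ([sqr_sum_sqrt_le]). *)

(** * Independence of generated sigma-algebras *)

Definition independent_systems {d} {T : measurableType d} {R : realType}
    (P : probability T R) (G H : set (set T)) : Prop :=
  forall A B, G A -> H B -> P (A `&` B) = (P A * P B)%E.

Lemma independent_systemsC {d} {T : measurableType d} {R : realType}
    (P : probability T R) (G H : set (set T)) :
  independent_systems P G H -> independent_systems P H G.
Proof. by move=> GH A B HA GB; rewrite setIC muleC GH. Qed.

(** For a fixed B in H the events A that are independent of B form a Dynkin
    system, so the pi-lambda theorem extends independence from the pi-system G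
    to the sigma-algebra it generates. *)
Lemma independent_g_sigma_algebral {d} {T : measurableType d} {R : realType}
    (P : probability T R) (G H : set (set T)) :
  setI_closed G -> G `<=` measurable -> H `<=` measurable ->
  independent_systems P G H -> independent_systems P <<s G >> H.
Proof.
move=> GI mG mH GH A B sGA HB; have mB := mH _ HB.
pose L := [set A | measurable A /\ P (A `&` B) = (P A * P B)%E].
suff: <<s G >> `<=` L by move=> /(_ _ sGA)[].
apply: lambda_system_subset => //; last first.
  by move=> C GC; split; [exact: mG|exact: GH].
apply/dynkin_lambda_system; split.
- by split=> //; rewrite setTI probability_setT mul1e.
- move=> C [mC PC]; split; first exact: measurableC.
  have PBE : P (~` C `&` B) = (P B - P (C `&` B))%E.
    by rewrite setIC -setDE measureD ?(setIC C B)//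
      (le_lt_trans (probability_le1 P mB))// ltry.
  rewrite PBE PC probability_setC//.
  by rewrite -(fineK (fin_num_measure P _ mC)) -(fineK (fin_num_measure P _ mB))
    -EFinM -!EFinB -EFinM mulrBl mul1r.
- move=> F tF LF; have mF n : measurable (F n) by have [] := LF n.
  split; first exact: bigcupT_measurable.
  rewrite setI_bigcupl !measure_bigcup//=; last 2 first.
  + by move=> n _; exact: measurableI.
  + exact: trivIset_setIr.
  under eq_eseriesr do rewrite (LF _).2.
  rewrite muleC -(fineK (fin_num_measure P _ mB)) -nneseriesZl//.
  by apply: eq_eseriesr => n _; rewrite muleC.
Qed.

Lemma independent_g_sigma_algebra {d} {T : measurableType d} {R : realType}
    (P : probability T R) (G H : set (set T)) :
  setI_closed G -> setI_closed H -> G `<=` measurable -> H `<=` measurable ->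
  independent_systems P G H -> independent_systems P <<s G >> <<s H >>.
Proof.
move=> GI HI mG mH GH.
have sGm : <<s G >> `<=` measurable.
  by apply: smallest_sub => //; exact: sigma_algebra_measurable.
apply: independent_systemsC; apply: independent_g_sigma_algebral => //.
by apply: independent_systemsC; exact: independent_g_sigma_algebral.
Qed.

(** * Expectation of products *)

(** Independence says that the law of (Y, Z) and the product of the two laws
    agree on rectangles, hence everywhere; Tonelli's theorem then splits the
    integral. *)
Lemma ge0_integral_mul_independent {d d1 d2} {T : measurableType d}
    {T1 : measurableType d1} {T2 : measurableType d2} {R : realType}
    (P : probability T R) (Y : {RV P >-> T1}) (Z : {RV P >-> T2})
    (f : T1 -> \bar R) (g : T2 -> \bar R) :
  (forall A B, measurable A -> measurable B ->
     P (Y @^-1` A `&` Z @^-1` B) = (P (Y @^-1` A) * P (Z @^-1` B))%E) ->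
  measurable_fun setT f -> measurable_fun setT g ->
  (forall y, 0 <= f y)%E -> (forall z, 0 <= g z)%E ->
  (\int[P]_w (f (Y w) * g (Z w)) =
   \int[P]_w f (Y w) * \int[P]_w g (Z w))%E.
Proof.
move=> YZ mf mg f0 g0.
pose YZ2 w := (Y w, Z w).
have mYZ : measurable_fun setT YZ2 by exact: measurable_fun_pair.
pose W : {RV P >-> (T1 * T2)%type} :=
  HB.pack YZ2 (isMeasurableFun.Build _ _ _ _ _ mYZ).
have Efg X : measurable X ->
    (distribution P Y \x distribution P Z)%E X = distribution P W X.
  by apply: product_measure_unique => A B mA mB; exact: YZ.
have mm : measurable_fun setT (fun z : T1 * T2 => f z.1 * g z.2)%E.
  by apply: emeasurable_funM; exact: measurableT_comp.
have m0 (z : T1 * T2) : (0 <= f z.1 * g z.2)%E by exact: mule_ge0.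
transitivity (\int[distribution P W]_z (f z.1 * g z.2))%E.
  by rewrite ge0_integral_pushforward.
transitivity (\int[(distribution P Y \x distribution P Z)]_z (f z.1 * g z.2))%E.
  by apply: eq_measure_integral => A mA _; exact/esym/Efg.
rewrite fubini_tonelli1//= /fubini_F/=.
under eq_integral do rewrite ge0_integralZl//.
rewrite ge0_integralZr//; last exact: integral_ge0.
by rewrite !ge0_integral_pushforward.
Qed.

Lemma expectation_mul_independent {d} {T : measurableType d} {R : realType}
    (P : probability T R) (f g : T -> R) :
  measurable_fun setT f -> measurable_fun setT g ->
  (forall A B, measurable A -> measurable B ->
     P (f @^-1` A `&` g @^-1` B) = (P (f @^-1` A) * P (g @^-1` B))%E) ->
  (forall w, 0 <= f w) -> (forall w, 0 <= g w) ->
  ('E_P[fun w => (f w * g w)%R] = 'E_P[f] * 'E_P[g])%E.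
Proof.
move=> mf mg fg f0 g0.
pose Y : {RV P >-> R} := HB.pack f (isMeasurableFun.Build _ _ _ _ _ mf).
pose Z : {RV P >-> R} := HB.pack g (isMeasurableFun.Build _ _ _ _ _ mg).
have mabs : measurable_fun [set: R] (fun x : R => `|x|%:E).
  by apply/measurable_EFinP; exact: normr_measurable.
(* The absolute value extends the identity on nonnegative reals to a function
   that is nonnegative on the whole line. *)
have := @ge0_integral_mul_independent _ _ _ _ _ _ _ P Y Z
  (fun x : R => `|x|%:E) (fun x : R => `|x|%:E) fg mabs mabs.
rewrite unlock.
under eq_integral do rewrite -EFinM !ger0_norm//=.
under [in X in (X * _)%E]eq_integral do rewrite ger0_norm//=.
under [in X in (_ * X)%E]eq_integral do rewrite ger0_norm//=.
by apply=> x; rewrite lee_fin.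
Qed.

(** * Disjoint groups of independent random variables *)

(** A pi-system generating sigma(X_i, i in F).  Indexing by families of
    measurable sets rather than taking the union of the sigma(X_i) is what makes
    it closed under intersection. *)
Definition cylinders {d d'} {T : measurableType d} {T' : measurableType d'}
    {R : realType} {P : probability T R} {I : finType} (X : I -> {RV P >-> T'})
    (F : {set I}) : set (set T) :=
  [set \bigcap_(i in [set` F]) (X i @^-1` A i) |
    A in [set A : I -> set T' | forall i, measurable (A i)]].

Section cylinders.
Context {d d'} {T : measurableType d} {T' : measurableType d'}
    {R : realType} {P : probability T R} {I : finType} (X : I -> {RV P >-> T'}).
Implicit Types F : {set I}.

Lemma cylinders_measurable F : cylinders X F `<=` measurable.
Proof.
move=> _ [A mA <-]; apply: fin_bigcap_measurable => // i _.
by rewrite -[X in measurable X]setTI; exact: measurable_funPT.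
Qed.

Lemma cylinders_setI F : setI_closed (cylinders X F).
Proof.
move=> _ _ [A mA <-] [B mB <-]; exists (fun i => A i `&` B i).
  by move=> i; exact: measurableI.
by rewrite -bigcapI; apply: eq_bigcapr.
Qed.

Lemma cylinders_sub F F' : F \subset F' -> cylinders X F `<=` cylinders X F'.
Proof.
move=> /fintype.subsetP FF' _ [A mA <-].
exists (fun i => if i \in F then A i else setT).
  by move=> i /=; case: ifP.
apply/seteqP; split => [w Aw i Fi|w Aw i /= F'i].
  by have := Aw i (FF' _ Fi); rewrite /= (_ : (i \in F) = true).
by case: ifPn => // Fi; exact: Aw.
Qed.

(** The two families of sets are merged into one family indexed by the union of
    F and F', to which the product rule is applied, as well as to F and F'
    separately. *)
Lemma cylinders_independent F F' : mutually_independent X ->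
  [disjoint F & F']%B -> independent_systems P (cylinders X F) (cylinders X F').
Proof.
move=> iX dFF' _ _ [A mA <-] [B mB <-].
pose D i := if i \in F then A i else B i.
have DA i : i \in F -> D i = A i by rewrite /D => ->.
have DB i : i \in F' -> D i = B i.
  by move=> F'i; rewrite /D (disjointFl dFF' F'i).
have -> : \bigcap_(i in [set` F]) (X i @^-1` A i) `&`
          \bigcap_(i in [set` F']) (X i @^-1` B i) =
          \bigcap_(i in [set` (F :|: F')%SET]) (X i @^-1` D i).
  apply/seteqP; split => [w [Aw Bw] i /=|w Dw].
    by rewrite finset.in_setU => /orP[iF|iF]; [rewrite DA//|rewrite DB//];
      [exact: Aw|exact: Bw].
  split=> i /= iF.
    by have := Dw i; rewrite /= finset.in_setU iF /= DA//; apply.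
  by have := Dw i; rewrite /= finset.in_setU iF orbT /= DB//; apply.
rewrite !iX//; last by move=> i _; rewrite /D; case: ifP.
rewrite (eq_bigl [predU F & F']); last by move=> i; rewrite !inE.
rewrite bigU//=; congr (_ * _)%E.
  by apply: eq_bigr => i /DA ->.
by apply: eq_bigr => i /DB ->.
Qed.

Lemma measurable_cylinders F i : i \in F ->
  measurable_fun [set: g_sigma_algebraType (cylinders X F)] (X i).
Proof.
move=> iF _ B mB; rewrite setTI; apply: sub_sigma_algebra.
exists (fun j => if j == i then B else setT).
  by move=> j; case: ifP.
apply/seteqP; split => [w /(_ i iF)|w Bw j /= jF]; first by rewrite /= eqxx.
by case: eqP => // ->.
Qed.

End cylinders.

Definition measurable_wrt {d d'} {T : measurableType d} {T' : measurableType d'}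
    {R : realType} {P : probability T R} {I : finType} (X : I -> {RV P >-> T'})
    (F : {set I}) (f : T -> R) : Prop :=
  measurable_fun [set: g_sigma_algebraType (cylinders X F)] f.

Section grouping.
Context {d d'} {T : measurableType d} {T' : measurableType d'}
    {R : realType} {P : probability T R} {I : finType} (X : I -> {RV P >-> T'}).
Implicit Types F : {set I}.

Lemma measurable_wrt_sub F F' f : F \subset F' ->
  measurable_wrt X F f -> measurable_wrt X F' f.
Proof.
move=> FF' mf mT B mB; have := mf measurableT B mB.
move: {mf}(_ `&` _); apply: smallest_sub; first exact: smallest_sigma_algebra.
move=> C FC; apply: sub_sigma_algebra; exact: cylinders_sub FC.
Qed.

Lemma measurable_wrt_measurable F f :
  measurable_wrt X F f -> measurable_fun [set: T] f.
Proof.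
move=> mf mT B mB; have := mf measurableT B mB.
move: {mf}(_ `&` _); apply: smallest_sub; first exact: sigma_algebra_measurable.
move=> C FC; exact: cylinders_measurable FC.
Qed.

(** By the pi-lambda theorem, the independence of the cylinders over F and F'
    passes to the preimages of f and g, which lie in the sigma-algebras that
    these cylinders generate. *)
Lemma expectation_mul_disjoint F F' f g : mutually_independent X ->
  [disjoint F & F']%B -> measurable_wrt X F f -> measurable_wrt X F' g ->
  (forall w, 0 <= f w) -> (forall w, 0 <= g w) ->
  ('E_P[fun w => (f w * g w)%R] = 'E_P[f] * 'E_P[g])%E.
Proof.
move=> iX dFF' mf mg f0 g0; apply: expectation_mul_independent => //.
- exact: measurable_wrt_measurable mf.
- exact: measurable_wrt_measurable mg.
move=> A B mA mB.
apply: (independent_g_sigma_algebra P (cylinders X F) (cylinders X F')).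
- exact: cylinders_setI.
- exact: cylinders_setI.
- exact: cylinders_measurable.
- exact: cylinders_measurable.
- exact: cylinders_independent.
- by have := mf measurableT A mA; rewrite setTI.
- by have := mg measurableT B mB; rewrite setTI.
Qed.

(** Induction on s: the factors after the first are measurable for the
    variables indexed by the union of their index sets, which is disjoint from
    the first index set. *)
Lemma expectation_prod_disjoint (s : seq {set I}) (Z : {set I} -> T -> R) :
  mutually_independent X ->
  pairwise (fun e f : {set I} => [disjoint e & f]%B) s ->
  (forall e, e \in s -> measurable_wrt X e (Z e)) ->
  (forall e w, 0 <= Z e w) ->
  ('E_P[fun w => (\prod_(e <- s) Z e w)%R] = \prod_(e <- s) 'E_P[Z e])%E.
Proof.
move=> iX; elim: s => [|e s IH] /=.
  move=> _ _ _; rewrite big_nil; under eq_fun do rewrite big_nil.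
  exact: expectation_cst.
move=> /andP[/allP es dis] mZ Z0.
rewrite big_cons -IH//; last by move=> f fs; apply: mZ; rewrite inE fs orbT.
under eq_fun do rewrite big_cons.
apply: (@expectation_mul_disjoint e (\bigcup_(f in s) f)%SET) => //.
- by apply/bigcup_disjoint => f; exact: es.
- by apply: mZ; rewrite inE eqxx.
- apply: measurable_prod => f fs; apply: (@measurable_wrt_sub f).
    exact: finset.bigcup_sup.
  by apply: mZ; rewrite inE fs orbT.
- by move=> w; exact: prodr_ge0.
Qed.

End grouping.

(** * Sums of sub-Gaussian variables *)

(** Jensen's inequality for the exponential, by comparing it with its tangent
    line at the mean m. *)
Lemma le_expR_average {R : realType} {I : finType} (q x : I -> R) :
  (forall i, 0 <= q i) -> \sum_i q i = 1 ->
  expR (\sum_i q i * x i) <= \sum_i q i * expR (x i).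
Proof.
move=> q0 q1; set m := \sum_i q i * x i.
have -> : expR m = \sum_i q i * (expR m * (1 + (x i - m))).
  rewrite -[LHS]mulr1.
  under eq_bigr do rewrite mulrCA mulrDr mulr1 mulrBr.
  by rewrite -mulr_sumr big_split/= sumrB -mulr_suml q1 mul1r subrr addr0.
apply: ler_sum => i _; apply: ler_wpM2l => //.
have -> : expR (x i) = expR m * expR (x i - m) by rewrite -expRD addrC subrK.
by rewrite ler_wpM2l ?expR_ge0// expR_ge1Dx.
Qed.

(** Without any independence, sub-Gaussian standard deviations add up.  The
    weights q proportional to the standard deviations are the optimal choice:
    they make mu / q i * S i have the same bound for every i.  The hypothesis on
    the i with v i = 0 is what allows them to receive the weight 0. *)
Lemma expectation_expR_sum {d} {T : measurableType d} {R : realType}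
    (P : probability T R) {I : finType} (S : I -> T -> R) (v : I -> R) :
  (forall i, measurable_fun setT (S i)) -> (forall i, 0 <= v i) ->
  (forall i, v i = 0 -> forall w, S i w = 0) ->
  (forall i mu, 0 < mu ->
    ('E_P[fun w => expR (mu * S i w)] <= (expR (mu ^+ 2 * v i / 2))%:E)%E) ->
  forall mu, 0 < mu ->
    ('E_P[fun w => expR (mu * \sum_i S i w)] <=
     (expR (mu ^+ 2 * (\sum_i Num.sqrt (v i)) ^+ 2 / 2))%:E)%E.
Proof.
move=> mS v0 S0 ES mu mu0; set Q := \sum_i _.
have Q0 : 0 <= Q by apply: sumr_ge0 => i _; exact: sqrtr_ge0.
have [Qz|Qn0] := eqVneq Q 0.
  have vz i : v i = 0.
    apply/eqP; rewrite eq_le v0 andbT -sqrtr_eq0; apply/eqP.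
    by apply: psumr_eq0P Qz i isT => j _; exact: sqrtr_ge0.
  have -> : (fun w => expR (mu * \sum_i S i w)) = cst 1.
    apply/funext => w; rewrite big1 ?mulr0 ?expR0// => i _.
    exact: S0.
  by rewrite expectation_cst lee_fin Qz expr0n mulr0 mul0r expR0.
have Qp : 0 < Q by rewrite lt_neqAle eq_sym Qn0.
pose q i := Num.sqrt (v i) / Q.
have q0 i : 0 <= q i by rewrite divr_ge0 ?sqrtr_ge0.
have q1 : \sum_i q i = 1 by rewrite -mulr_suml divff.
(* For v i = 0 the division by q i = 0 is harmless, since S i vanishes. *)
have qS i w : mu * S i w = q i * (mu / q i * S i w).
  have [vi|vi] := eqVneq (v i) 0; first by rewrite S0// !mulr0.
  rewrite mulrA [q i * _]mulrC divfK//.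
  by rewrite mulf_neq0 ?invr_eq0// sqrtr_eq0 -ltNge lt_neqAle eq_sym vi v0.
have mE c i : measurable_fun [set: T] (fun w => expR (c * S i w)).
  by apply: measurableT_comp => //; exact: measurable_funM.
rewrite unlock.
apply: (@le_trans _ _
  (\int[P]_w (\sum_i (q i)%:E * (expR (mu / q i * S i w))%:E))%E).
  apply: ge0_le_integral => //.
  - apply/measurable_EFinP; apply: measurableT_comp => //.
    by apply: measurable_funM => //; exact: measurable_sum.
  - apply: emeasurable_sum => i; apply: emeasurable_funM => //.
    exact/measurable_EFinP.
  - move=> w _; under [leRHS]eq_bigr do rewrite -EFinM.
    rewrite sumEFin lee_fin mulr_sumr; under eq_bigr do rewrite qS.
    exact: le_expR_average.
rewrite ge0_integral_sum//=; last 2 first.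
- by move=> i; apply: emeasurable_funM => //; exact/measurable_EFinP.
- by move=> i w _; rewrite -EFinM lee_fin mulr_ge0 ?expR_ge0.
set b := expR (_ / 2).
have -> : b = \sum_i q i * b by rewrite -mulr_suml q1 mul1r.
rewrite -sumEFin.
apply: lee_sum => i _.
rewrite ge0_integralZl//; last 2 first.
- exact/measurable_EFinP.
- by rewrite lee_fin.
have [qi|qi] := eqVneq (q i) 0; first by rewrite qi mul0e mul0r.
rewrite [leRHS]EFinM; apply: lee_wpmul2l; first by rewrite lee_fin.
rewrite /b.
have -> : mu ^+ 2 * Q ^+ 2 / 2 = (mu / q i) ^+ 2 * v i / 2.
  have sv0 : Num.sqrt (v i) != 0.
    by apply: contraNneq qi; rewrite /q => ->; rewrite mul0r.
  by rewrite -{1}(sqr_sqrtr (v0 i)) /q; field; rewrite Qn0 sv0.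
have := ES i (mu / q i); rewrite unlock; apply.
by rewrite divr_gt0// lt_neqAle eq_sym qi q0.
Qed.

(** Cauchy-Schwarz, read off from the nonnegativity of the empirical variance of
    the K numbers sqrt (v k), here multiplied by K ^ 3 to avoid divisions. *)
Lemma sqr_sum_sqrt_le {R : rcfType} (K : nat) (v : 'I_K -> R) :
  (forall k, 0 <= v k) -> (\sum_k Num.sqrt (v k)) ^+ 2 <= K%:R * \sum_k v k.
Proof.
move=> v0; set Q := \sum_k _.
have [K0|K0] := posnP K.
  by subst K; rewrite mul0r /Q big_ord0 expr0n.
have KR : 0 < K%:R :> R by rewrite ltr0n.
have : 0 <= \sum_k (K%:R * Num.sqrt (v k) - Q) ^+ 2.
  by apply: sumr_ge0 => k _; exact: sqr_ge0.
have -> : \sum_k (K%:R * Num.sqrt (v k) - Q) ^+ 2 =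
    K%:R * (K%:R * \sum_k v k - Q ^+ 2).
  transitivity (\sum_k
      (K%:R ^+ 2 * v k + - (2 * K%:R * Q) * Num.sqrt (v k) + Q ^+ 2)).
    by apply: eq_bigr => k _; rewrite -{2}(sqr_sqrtr (v0 k)); ring.
  rewrite !big_split/= -!mulr_sumr -/Q sumr_const card_ord -mulr_natl; ring.
by rewrite pmulr_rge0// subr_ge0.
Qed.

Lemma measurable_sum_in {d} {T : measurableType d} {R : realType}
    {J : finType} (A : {set J}) (Z : J -> T -> R) :
  (forall j, j \in A -> measurable_fun [set: T] (Z j)) ->
  measurable_fun [set: T] (fun w => \sum_(j in A) Z j w).
Proof.
move=> mZ.
pose Z0 j w := if j \in A then Z j w else 0.
have -> : (fun w => \sum_(j in A) Z j w) = (fun w => \sum_j Z0 j w).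
  by apply/funext => w; rewrite big_mkcond.
apply: measurable_sum => j; rewrite /Z0.
by case: (j \in A) (mZ j) => // /(_ isT).
Qed.

Section subgaussian.
Context {d d'} {T : measurableType d} {T' : measurableType d'}
    {R : realType} {P : probability T R} {I : finType} (X : I -> {RV P >-> T'}).
Variables (Y : {set I} -> T -> R) (v : {set I} -> R).

(** Variance proxies, unlike in the dependent case, add over pairwise disjoint
    hyper-edges, since the moment generating function factorizes. *)
Lemma expectation_expR_sum_matching (M : {set {set I}}) :
  mutually_independent X ->
  (forall e f, e \in M -> f \in M -> e != f -> [disjoint e & f]%B) ->
  (forall e, e \in M -> measurable_wrt X e (Y e)) ->
  (forall e, e \in M -> forall mu, 0 < mu ->
    ('E_P[fun w => expR (mu * Y e w)] <= (expR (mu ^+ 2 * v e / 2))%:E)%E) ->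
  forall mu, 0 < mu ->
    ('E_P[fun w => expR (mu * \sum_(e in M) Y e w)] <=
     (expR (mu ^+ 2 * (\sum_(e in M) v e) / 2))%:E)%E.
Proof.
move=> iX disM mY EY mu mu0.
have -> : (fun w => expR (mu * \sum_(e in M) Y e w)) =
          (fun w => \prod_(e <- enum M) expR (mu * Y e w)).
  by apply/funext => w; rewrite mulr_sumr expR_sum -big_enum.
rewrite (expectation_prod_disjoint X (enum M)
  (fun e w => expR (mu * Y e w)))//; last 2 first.
- apply: (@sub_in_pairwise _ (mem M) (fun e f => e != f)).
  + by move=> e f; exact: disM.
  + by apply/allP => e; rewrite mem_enum.
  + by rewrite -uniq_pairwise enum_uniq.
- move=> e; rewrite mem_enum => eM; apply: measurableT_comp => //.
  by apply: measurable_funM => //; exact: mY.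
rewrite mulr_sumr mulr_suml expR_sum big_enum/=.
suff /andP[//] : (0 <= \prod_(e in M) 'E_P[fun w => expR (mu * Y e w)] <=
    (\prod_(e in M) expR (mu ^+ 2 * v e / 2))%:E)%E.
elim/big_rec2: _ => [|e y x eM /andP[x0 xy]]; first by rewrite lee01 lexx.
have E0 : (0 <= 'E_P[fun w => expR (mu * Y e w)])%E.
  by apply: expectation_ge0 => w; exact: expR_ge0.
by rewrite EFinM mule_ge0//= lee_pmul// EY.
Qed.

(** Variance proxies add inside each color class and standard deviations add
    over the classes; Cauchy-Schwarz over the classes gives the factor K. *)
Lemma expectation_expR_sum_coloring (E : {set {set I}}) (K : nat)
    (C : 'I_K -> {set {set I}}) :
  mutually_independent X -> proper_edge_coloring E C ->
  (forall e, e \in E -> 0 < v e) ->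
  (forall e, e \in E -> measurable_wrt X e (Y e)) ->
  (forall e, e \in E -> forall mu, 0 < mu ->
    ('E_P[fun w => expR (mu * Y e w)] <= (expR (mu ^+ 2 * v e / 2))%:E)%E) ->
  forall mu, 0 < mu ->
    ('E_P[fun w => expR (mu * \sum_(e in E) Y e w)] <=
     (expR (mu ^+ 2 * (K%:R * \sum_(e in E) v e) / 2))%:E)%E.
Proof.
move=> iX [EC dC mC] v0 mY EY mu mu0.
have CE k e : e \in C k -> e \in E.
  by move=> eC; rewrite EC; apply/existsP; exists k.
have sumE (F : {set I} -> R) : \sum_(e in E) F e = \sum_k \sum_(e in C k) F e.
  rewrite -partition_disjoint_bigcup//; apply: eq_bigl => e.
  rewrite EC; apply/existsP/bigcupP => [[k]|[k _]] eC; by exists k.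
have V0 k : 0 <= \sum_(e in C k) v e.
  by apply: sumr_ge0 => e /CE /v0 /ltW.
rewrite sumE.
have -> : (fun w => expR (mu * \sum_(e in E) Y e w)) =
    (fun w => expR (mu * \sum_k \sum_(e in C k) Y e w)).
  by apply/funext => w; rewrite sumE.
apply: (le_trans (expectation_expR_sum P (fun k w => \sum_(e in C k) Y e w)
   (fun k => \sum_(e in C k) v e) _ _ _ _ _ mu0)) => //.
- move=> k; apply: measurable_sum_in => e /CE eE.
  exact: measurable_wrt_measurable (mY _ eE).
(* A class with variance proxy 0 is empty, because each v e is positive. *)
- move=> k vk w; apply: big1 => e eC.
  have := psumr_eq0P _ vk eC => /(_ (fun e eC => ltW (v0 _ (CE _ _ eC)))) ve.
  by have := v0 _ (CE _ _ eC); rewrite ve ltxx.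
- move=> k nu nu0; apply: expectation_expR_sum_matching => //.
  + exact: mC.
  + by move=> e /CE; exact: mY.
  + by move=> e /CE; exact: EY.
rewrite lee_fin ler_expR ler_pM2r// ler_pM2l ?exprn_gt0//.
exact: sqr_sum_sqrt_le.
Qed.

End subgaussian.

(** Chernoff's bound exp (mu ^ 2 * v / 2 - mu * t) at its minimizer
    mu = t / v. *)
Lemma subgaussian_tail {d} {T : measurableType d} {R : realType}
    (P : probability T R) (Y : T -> R) (v : R) :
  measurable_fun [set: T] Y -> 0 < v ->
  (forall mu, 0 < mu ->
    ('E_P[fun w => expR (mu * Y w)] <= (expR (mu ^+ 2 * v / 2))%:E)%E) ->
  forall t, 0 < t ->
    (P [set w | (t < Y w)%R] <= (expR (- (t ^+ 2 / (2 * v))))%:E)%E.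
Proof.
move=> mY v0 EY t t0.
pose YT : {RV P >-> R} := HB.pack Y (isMeasurableFun.Build _ _ _ _ _ mY).
have r0 : 0 < t / v by rewrite divr_gt0.
apply: (@le_trans _ _ (P [set w | (t <= YT w)%R])).
  apply: le_measure; rewrite ?inE.
  - have := mY measurableT _ (measurable_itv `]t, +oo[%R).
    by rewrite setTI; congr measurable; apply/seteqP; split=> w /=;
      rewrite in_itv/= andbT.
  - have := mY measurableT _ (measurable_itv `[t, +oo[%R).
    by rewrite setTI; congr measurable; apply/seteqP; split=> w /=;
      rewrite in_itv/= andbT.
  - by move=> w /= /ltW.
apply: (le_trans (chernoff YT t r0)).
have -> : 'M_P YT (t / v) = 'E_P[fun w => expR (t / v * Y w)]%E.
  by rewrite /mmt_gen_fun; congr expectation;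
    apply/funext => w /=; rewrite mulrC.
apply: (le_trans (lee_wpmul2r _ (EY _ r0))); first by rewrite lee_fin expR_ge0.
rewrite -EFinM -expRD lee_fin ler_expR le_eqVlt; apply/orP; left; apply/eqP.
by field; exact: lt0r_neq0.
Qed.

(** * The concentration inequality *)

(** The listing of e only visits vertices of e, so the kernel value is a
    function of the X_i with i in e. *)
Lemma edge_value_measurable_wrt {d} {T : measurableType d} {R : realType}
    {P : probability T R} {p m : nat} {V : finType}
    (X : V -> {RV P >-> p.-tuple R}) (ord : {set V} -> m.-tuple V)
    (h : {set V} -> m.-tuple (p.-tuple R) -> R) (e : {set V}) :
  {subset ord e <= e} ->
  measurable_fun [set: m.-tuple (p.-tuple R)] (h e) ->
  measurable_wrt X e (edge_value X ord h e).
Proof.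
move=> orde mh; apply: (measurableT_comp mh).
apply/measurable_fun_tnthP => j.
have mXj : measurable_fun [set: g_sigma_algebraType (cylinders X e)]
    (X (tnth (ord e) j)).
  by apply: measurable_cylinders; apply: orde; exact: mem_tnth.
apply: eq_measurable_fun mXj.
  by move=> w _ /=; rewrite tnth_mktuple.
Qed.

Local Close Scope classical_set_scope.

Theorem theorem7 (d : measure_display) (T : measurableType d) (R : realType)
    (P : probability T R) (n m p K : nat)
    (X : 'I_n -> {RV P >-> p.-tuple R})
    (E : {set {set 'I_n}}) (ord : {set 'I_n} -> m.-tuple 'I_n)
    (h : {set 'I_n} -> m.-tuple (p.-tuple R) -> R)
    (sigma : {set 'I_n} -> R) :
  (2 <= m)%N ->
  mutually_independent X ->
  E != finset.set0 -> uniform_hypergraph m E -> edge_ordering E ord ->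
  (forall e, e \in E -> measurable_fun [set: m.-tuple (p.-tuple R)]%classic (h e)) ->
  (forall e, e \in E ->
     P.-integrable [set: T]%classic (EFin \o edge_value X ord h e)) ->
  (forall e, e \in E -> 0 < sigma e) ->
  (forall e, e \in E -> forall lambda : R, 0 < lambda ->
     ('E_P[fun w => expR (lambda *
              (edge_value X ord h e w - fine 'E_P[edge_value X ord h e]))]
      <= (expR (lambda ^+ 2 * sigma e ^+ 2 / 2))%:E)%E) ->
  (exists C : 'I_K -> {set {set 'I_n}}, proper_edge_coloring E C) ->
  forall t : R, 0 < t ->
    (P [set w | (t < Ustat X ord h E w - fine 'E_P[Ustat X ord h E])%R]%classic
     <= (expR (- (t ^+ 2 / (2 * K%:R * \sum_(e in E) sigma e ^+ 2))))%:E)%E.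
Proof.
move=> _ iX E0 _ ordE mh hint s0 hE [C hC] t t0.
set Y := edge_value X ord h.
pose Yc e w := Y e w - fine 'E_P[Y e].
have wE e : e \in E -> measurable_wrt X e (Y e).
  move=> eE.
  by apply: edge_value_measurable_wrt; [move=> i; rewrite ordE|exact: mh].
have wcE e : e \in E -> measurable_wrt X e (Yc e).
  by move=> eE; apply: measurable_funB => //; exact: wE.
have EU : fine 'E_P[Ustat X ord h E] = \sum_(e in E) fine 'E_P[Y e].
  have -> : Ustat X ord h E = \sum_(f <- [seq Y e | e <- enum E]) f.
    by rewrite big_map big_enum fct_sumE.
  rewrite expectation_sum => [|_ /mapP[e + ->]]; last first.
    by rewrite mem_enum => eE; apply/Lfun1_integrable; exact: hint.
  rewrite big_map big_enum sum_fine// => e eE.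
  by apply: expectation_fin_num; apply/Lfun1_integrable; exact: hint.
have UE w : Ustat X ord h E w - fine 'E_P[Ustat X ord h E] =
    \sum_(e in E) Yc e w.
  by rewrite EU -sumrB.
have K0 : 0 < K%:R :> R.
  case/finset.set0Pn: E0 => e; case: hC => -> _ _ /existsP[k _].
  by rewrite ltr0n (leq_ltn_trans _ (ltn_ord k)).
have v0 : 0 < \sum_(e in E) sigma e ^+ 2.
  case/finset.set0Pn: E0 => e eE.
  rewrite (bigD1 e)//= ltr_pwDl ?exprn_gt0 ?s0//.
  by apply: sumr_ge0 => f _; exact: sqr_ge0.
rewrite [X in P X](_ : _ =
  [set w | t < \sum_(e in E) Yc e w]%classic); last first.
  by apply/seteqP; split=> w /=; rewrite UE.
rewrite -mulrA; apply: subgaussian_tail => //.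
- apply: measurable_sum_in => e eE.
  exact: measurable_wrt_measurable (wcE e eE).
- exact: mulr_gt0.
- apply: (expectation_expR_sum_coloring X Yc
    (fun e => sigma e ^+ 2) E K C iX hC) => //.
  by move=> e eE; rewrite exprn_gt0 ?s0.
Qed.
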